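(* Let $(X_n,S_n,Y_n,Z_n)$, $n\ge 0$, be the Markov chain of the (discrete) pattern model described in the context, with arbitrary initial distribution of $X_0$. Then the reduced process $(X_n,S_n,Z_n)$, $n\ge 0$, obtained by dropping the subject's response $Y_n$, is a Markov chain.
   Context: The model (based on the continuous pattern model of Suppes). A subject repeatedly predicts which location on the rim of a disk will be illuminated. Let $\mathcal{Y}$ be a discrete (countable) set of locations and $\mathcal{S}$ a finite set of $N\ge 1$ stimulus patterns. A state of learning is a function $x:\mathcal{S}\to\mathcal{Y}$, $s\mapsto x_s$. For each $s\in\mathcal{S}$, let $\lambda_s(\cdot,\cdot)$ be a stochastic kernel on $\mathcal{Y}$ (so $\lambda_s(w,\cdot)$ is a probability distribution on $\mathcal{Y}$ for each $w\in\mathcal{Y}$), and let $\pi(\cdot,\cdot)$ be a stochastic kernel on $\mathcal{Y}$. On trial $n$, given the state of learning $X_n=x$ and the entire past before trial $n$: a pattern $S_n=s$ is sampled uniformly from $\mathcal{S}$ (each with probability $1/N$); given $S_n=s$, the prediction $Y_n$ is drawn from $\lambda_s(x_s,\cdot)$; given also $Y_n=y$, the location $Z_n$ actually illuminated is drawn from $\pi(y,\cdot)$. The state of learning is then updated deterministically: if $S_n=s$ and $Z_n=z$, then $X_{n+1}$ is the function with $(X_{n+1})_s=z$ and $(X_{n+1})_t=x_t$ for all $t\ne s$. *)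

(* Defs.v *)
From HB Require Import structures.
From mathcomp Require Import all_boot all_order all_algebra.
From mathcomp Require Import all_classical all_reals all_analysis.

Set Implicit Arguments.
Unset Strict Implicit.
Unset Printing Implicit Defensive.

Import Order.TTheory GRing.Theory Num.Theory.
Local Open Scope classical_set_scope.
Local Open Scope ring_scope.

(* Kernels between countable sets are given by their matrix of one-point
   probabilities. *)
Definition stochastic_kernel (R : realType) (T U : countType)
    (k : T -> U -> R) : Prop :=
  (forall t u, 0 <= k t u) /\
  (forall t, (\esum_(u in [set: U]) (k t u)%:E = 1)%E).

(* Only meaningful when P B > 0; all uses below assume this. *)
Definition cond_prob (R : realType) (d : measure_display)
    (Omega : measurableType d) (P : probability Omega R) (A B : set Omega) : R :=
  fine (P (A `&` B)) / fine (P B).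

(* For a countable codomain with its discrete sigma-algebra, this is
   measurability. *)
Definition discrete_rv (d : measure_display) (Omega : measurableType d)
    (T : countType) (V : Omega -> T) : Prop :=
  forall t, measurable (V @^-1` [set t]).

(* Markov chain with countable state space and stationary transition
   probabilities. The values w 0, ..., w n of a sequence w : nat -> T range
   over all the possible histories up to time n. *)
Definition is_markov_chain (R : realType) (d : measure_display)
    (Omega : measurableType d) (P : probability Omega R)
    (T : countType) (W : nat -> Omega -> T) : Prop :=
  (forall n, discrete_rv (W n)) /\
  exists K : T -> T -> R, stochastic_kernel K /\
    forall (n : nat) (w : nat -> T) (v : T),
      let history := [set o | forall i, (i <= n)%N -> W i o = w i] in
      (0 < P history)%E ->
      cond_prob P (W n.+1 @^-1` [set v]) history = K (w n) v.

Section PatternModel.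
Variables (Loc : countType) (Pat : finType).

Definition update (x : {ffun Pat -> Loc}) (s : Pat) (z : Loc) :
    {ffun Pat -> Loc} :=
  [ffun t => if t == s then z else x t].

Variables (R : realType) (d : measure_display) (Omega : measurableType d).
Variable P : probability Omega R.
Variables (lambda : Pat -> Loc -> Loc -> R) (pi : Loc -> Loc -> R).
Variables (X : nat -> Omega -> {ffun Pat -> Loc}) (S : nat -> Omega -> Pat).
Variables (Y Z : nat -> Omega -> Loc).

(* The state on trial n is x n, and everything that happened on the trials
   0, ..., n-1 is as prescribed by x, s, y, z. *)
Definition before_trial (n : nat) (x : nat -> {ffun Pat -> Loc})
    (s : nat -> Pat) (y z : nat -> Loc) : set Omega :=
  [set o | X n o = x n /\
     forall i, (i < n)%N ->
       [/\ X i o = x i, S i o = s i, Y i o = y i & Z i o = z i]].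

(* Nothing is assumed about the law of X 0. *)
Record pattern_model : Prop := PatternModel {
  pattern_rv : forall n,
    [/\ discrete_rv (X n), discrete_rv (S n), discrete_rv (Y n)
      & discrete_rv (Z n)];
  pattern_sampling : forall n x s y z,
    let B := before_trial n x s y z in
    (0 < P B)%E ->
    forall s', cond_prob P (S n @^-1` [set s']) B = #|Pat|%:R^-1;
  pattern_prediction : forall n x s y z,
    let B := before_trial n x s y z `&` S n @^-1` [set s n] in
    (0 < P B)%E ->
    forall y', cond_prob P (Y n @^-1` [set y']) B
               = lambda (s n) (x n (s n)) y';
  pattern_outcome : forall n x s y z,
    let B := before_trial n x s y z `&` S n @^-1` [set s n]
             `&` Y n @^-1` [set y n] in
    (0 < P B)%E ->
    forall z', cond_prob P (Z n @^-1` [set z']) B = pi (y n) z';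
  pattern_learning : forall n,
    {ae P, forall o, X n.+1 o = update (X n o) (S n o) (Z n o)}
}.

End PatternModel.

(* Main.v *)
Require Import Defs.
From HB Require Import structures.
From mathcomp Require Import all_boot all_order all_algebra.
From mathcomp Require Import all_classical all_reals all_analysis.

(** Refine a history of the reduced process by the values of all past
responses.  Given such a refined history, the next pattern is uniform, and
averaging over the next response shows that the next outcome follows the
kernel product [lambda_s pi] evaluated at the current state.  This law does
not involve the past responses, so it survives summation over them; the
current state itself is almost surely a function of the previous reduced
state. *)

Set Implicit Arguments.
Unset Strict Implicit.
Unset Printing Implicit Defensive.

Import Order.TTheory GRing.Theory Num.Theory.
Local Open Scope classical_set_scope.
Local Open Scope ring_scope.
Local Open Scope ereal_scope.

(** * Nonnegative sums over countable types *)

Lemma esumZl (R : realType) (T : choiceType) (I : set T) (c : R)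
    (a : T -> \bar R) :
  (0 <= c)%R -> (forall i, 0 <= a i) ->
  \esum_(i in I) (c%:E * a i) = c%:E * \esum_(i in I) a i.
Proof.
(* Only this inequality needs finite partial sums; the converse is this one applied to [c^-1] and
   the family [c * a]. *)
have le (d : R) (b : T -> \bar R) : (0 <= d)%R -> (forall i, 0 <= b i) ->
    \esum_(i in I) (d%:E * b i) <= d%:E * \esum_(i in I) b i.
  move=> d0 b0; apply: ge_ereal_sup => _ [F FI <-].
  rewrite -ge0_mule_fsumr// lee_wpmul2l ?lee_fin//.
  by apply: ereal_sup_ubound; exists F.
move=> c0 a0; apply/eqP; rewrite eq_le le//=.
have [->|cN0] := eqVneq c 0%R.
  by rewrite mul0e; apply: esum_ge0 => i _; rewrite mul0e.
have {cN0} cp : (0 < c)%R by rewrite lt0r cN0.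
rewrite -lee_pdivlMl// (le_trans _ (le _ _ _ _))//.
- by apply: le_esum => i _; rewrite muleA -EFinM mulVf ?gt_eqF// mul1e.
- by rewrite invr_ge0 ltW.
- by move=> i; rewrite mule_ge0 ?a0// lee_fin ltW.
Qed.

Lemma esum_prodT (R : realType) (T U : choiceType) (a : T * U -> \bar R) :
  (forall k, 0 <= a k) ->
  \esum_(k in [set: T * U]) a k =
  \esum_(i in [set: T]) \esum_(j in [set: U]) a (i, j).
Proof.
move=> a0; rewrite esum_esum// (_ : _ `*`` _ = setT); last first.
  by apply/seteqP; split.
by apply: eq_esum => -[].
Qed.

Lemma esum_delta (R : realType) (T : choiceType) (t : T) (c : \bar R) :
  0 <= c -> \esum_(i in [set: T]) (if i == t then c else 0) = c.
Proof.
move=> c0; rewrite -[RHS](@esum_set1 _ _ t (fun=> c))// [RHS]esum_mkcond.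
by apply: eq_esum => i _; rewrite in_set1.
Qed.

Lemma probability_esum_fibers (R : realType) (d : measure_display)
    (Omega : measurableType d) (P : probability Omega R) (T : countType)
    (V : Omega -> T) (A : set Omega) :
  discrete_rv V -> measurable A ->
  P A = \esum_(t in [set: T]) P (A `&` V @^-1` [set t]).
Proof.
move=> mV mA.
(* Countable additivity is indexed by [nat], so the fibres are listed by their codes, with the empty
   set at integers that encode no value. *)
pose F n := if @pickle_inv T n is Some t then A `&` V @^-1` [set t] else set0.
have mF n : measurable (F n).
  by rewrite /F; case: pickle_inv => [t|] //; apply: measurableI => //; apply: mV.
have tF : trivIset setT F.
  apply/trivIsetP => i j _ _; rewrite /F.
  case Ei: (pickle_inv i) => [t|]; last by rewrite set0I.
  case Ej: (pickle_inv j) => [u|]; last by rewrite setI0.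
  move=> ij; apply/seteqP; split => // o [[_ /= Vt] [_ /= Vu]].
  move: ij => /eqP; apply.
  have := @pickle_invK T i; have := @pickle_invK T j.
  by rewrite /ocancel Ei Ej /= -Vt -Vu => <- <-.
have AF : A = \bigcup_n F n.
  apply/seteqP; split => [u Au|u [n _]].
    by exists (pickle (V u)) => //; rewrite /F pickleK_inv.
  by rewrite /F; case: pickle_inv => [t []|].
rewrite [in LHS]AF measure_bigcup//= (eq_eseriesl (Q := predT)); last first.
  by move=> n; rewrite in_setT.
rewrite nneseries_esumT; last by move=> n; exact: measure_ge0.
have pI : set_inj [set: T] (pickle : T -> nat).
  by move=> t u _ _; apply: (pcan_inj (@pickleK T)).
transitivity (\esum_(n in (pickle : T -> nat) @` setT) P (F n)).
  rewrite [RHS]esum_mkcond; apply: eq_esum => n _.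
  case: ifPn => // /negP nin; rewrite /F; case E: (pickle_inv n) => [t|].
    exfalso; apply: nin; rewrite inE; exists t => //.
    by have := @pickle_invK T n; rewrite /ocancel E.
  by rewrite measure0.
by rewrite esum_image//; apply: eq_esum => t _; rewrite /F pickleK_inv.
Qed.

(** * The uniform law and composition of stochastic kernels *)

Lemma esum_uniform (R : realType) (T : finType) : (1 <= #|T|)%N ->
  \esum_(t in [set: T]) ((#|T|%:R^-1 : R)%:E) = 1.
Proof.
move=> T0; rewrite esum_fset; last 2 first.
- exact: finite_finset.
- by move=> t _; rewrite lee_fin invr_ge0.
have -> : [set: T] = [set` enum T].
  by apply/seteqP; split => t //= _; rewrite mem_enum.
rewrite -fsbig_seq ?enum_uniq// big_enum/= sumEFin sumr_const.
by rewrite -(mulr_natr _^-1%R) mulVf// pnatr_eq0 -lt0n.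
Qed.

(** Kernels have real entries, hence the [fine]; for stochastic kernels it discards nothing, as the
    sum is then at most 1. *)
Definition kernel_comp (R : realType) (T U V : countType)
    (k : T -> U -> R) (l : U -> V -> R) (t : T) (v : V) : R :=
  fine (\esum_(u in [set: U]) (k t u * l u v)%:E).

Lemma stochastic_kernel_le1 (R : realType) (T U : countType)
    (k : T -> U -> R) t u : stochastic_kernel k -> (k t u <= 1)%R.
Proof.
move=> [k0 k1]; rewrite -lee_fin -(k1 t) -[leLHS](esum_set1 (a := EFin \o k t)).
  rewrite esum_mkcond; apply: le_esum => i _ /=.
  by case: ifP => // _; rewrite lee_fin.
by rewrite lee_fin.
Qed.

(** The entries of [l] are at most 1, so the sum is dominated termwise by a row of [k] and is
    finite. *)
Lemma kernel_compE (R : realType) (T U V : countType)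
    (k : T -> U -> R) (l : U -> V -> R) t v :
  stochastic_kernel k -> stochastic_kernel l ->
  (kernel_comp k l t v)%:E = \esum_(u in [set: U]) (k t u * l u v)%:E.
Proof.
move=> kk ll; have [k0 k1] := kk; have [l0 l1] := ll.
rewrite /kernel_comp fineK// ge0_fin_numE; last first.
  by apply: esum_ge0 => u _; rewrite lee_fin mulr_ge0.
apply: (@le_lt_trans _ _ 1); last by rewrite ltry.
rewrite -(k1 t); apply: le_esum => u _; rewrite lee_fin.
by rewrite -[leRHS]mulr1 ler_wpM2l// stochastic_kernel_le1.
Qed.

(** Tonelli: both sides are sums over pairs, related by swapping the coordinates. *)
Lemma esum_exchange (R : realType) (T U : choiceType) (a : T -> U -> \bar R) :
  (forall t u, 0 <= a t u) ->
  \esum_(t in [set: T]) \esum_(u in [set: U]) a t u =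
  \esum_(u in [set: U]) \esum_(t in [set: T]) a t u.
Proof.
move=> a0.
rewrite -(esum_prodT (a := fun k => a k.1 k.2))//.
rewrite -(esum_prodT (a := fun k => a k.2 k.1))//.
rewrite (reindex_esum setT setT (fun k : U * T => (k.2, k.1)))//.
by split => // [[? ?] [? ?] _ _ [-> ->]|[t u] _] //; exists (u, t).
Qed.

Lemma kernel_comp_stochastic (R : realType) (T U V : countType)
    (k : T -> U -> R) (l : U -> V -> R) :
  stochastic_kernel k -> stochastic_kernel l ->
  stochastic_kernel (kernel_comp k l).
Proof.
move=> kk ll; have [k0 k1] := kk; have [l0 l1] := ll; split=> [t v|t].
  by rewrite fine_ge0// esum_ge0// => u _; rewrite lee_fin mulr_ge0.
under eq_esum do rewrite kernel_compE//.
rewrite esum_exchange; last by move=> v u; rewrite lee_fin mulr_ge0.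
rewrite -(k1 t); apply: eq_esum => u _.
under eq_esum do rewrite EFinM.
by rewrite esumZl// ?l1 ?mule1// => v; rewrite lee_fin.
Qed.

(** * Conditional probabilities and discrete random variables *)

Lemma cond_probP (R : realType) (d : measure_display)
    (Omega : measurableType d) (P : probability Omega R) (A B : set Omega)
    (c : R) :
  measurable A -> measurable B -> 0 < P B ->
  cond_prob P A B = c <-> P (A `&` B) = c%:E * P B.
Proof.
move=> mA mB PB; rewrite /cond_prob.
have fB : P B \is a fin_num by exact: fin_num_measure.
have fAB : P (A `&` B) \is a fin_num.
  by apply: fin_num_measure; exact: measurableI.
have B0 : fine (P B) != 0%R by rewrite fine_eq0// gt_eqF.
split=> [<-|->]; last by rewrite fineM// mulfK.
by rewrite -[X in _ * X]fineK// -EFinM divfK// fineK.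
Qed.

(** When [B] is null both sides vanish. The assumptions of the model, which concern events of
    positive probability only, can thus be multiplied together without case distinctions. *)
Lemma cond_prob_mul (R : realType) (d : measure_display)
    (Omega : measurableType d) (P : probability Omega R) (A B : set Omega)
    (c : R) :
  measurable A -> measurable B -> (0 < P B -> cond_prob P A B = c) ->
  P (A `&` B) = c%:E * P B.
Proof.
move=> mA mB h; have [PB|] := ltP 0 (P B).
  by apply/cond_probP => //; exact: h.
rewrite measure_le0 => /eqP PB; rewrite PB mule0.
by apply/eqP; rewrite -measure_le0 -PB; exact: measureIr.
Qed.

Lemma discrete_rv_pair (d : measure_display) (Omega : measurableType d)
    (T U : countType) (V : Omega -> T) (W : Omega -> U) :
  discrete_rv V -> discrete_rv W -> discrete_rv (fun o => (V o, W o)).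
Proof.
move=> mV mW [t u].
rewrite [X in measurable X](_ : _ = V @^-1` [set t] `&` W @^-1` [set u]).
  exact: measurableI.
by apply/seteqP; split=> w /= [-> ->].
Qed.

Lemma discrete_rv_ffun (d : measure_display) (Omega : measurableType d)
    (I : finType) (T : countType) (V : I -> Omega -> T) :
  (forall i, discrete_rv (V i)) -> discrete_rv (fun o => [ffun i => V i o]).
Proof.
move=> mV f.
rewrite [X in measurable X](_ : _ = \bigcap_(i in setT) V i @^-1` [set f i]).
  by apply: fin_bigcap_measurable => [|i _]; [exact: finite_finset|exact: mV].
apply/seteqP; split=> w /= => [<- i _|h]; first by rewrite /= ffunE.
by apply/ffunP => i; rewrite ffunE; exact: h.
Qed.

Lemma measureI_ae (R : realType) (d : measure_display)
    (Omega : measurableType d) (P : probability Omega R) (A E : set Omega) :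
  measurable A -> measurable E -> P.-negligible (A `&` ~` E) ->
  P (A `&` E) = P A.
Proof.
move=> mA mE N; rewrite [RHS](measureDI _ mA mE).
by rewrite setDE (measure_negligible _ N) ?add0e//; apply: measurableD.
Qed.

Lemma discrete_history_measurable (d : measure_display)
    (Omega : measurableType d) (T : countType) (W : nat -> Omega -> T) n
    (w : nat -> T) :
  (forall i, discrete_rv (W i)) ->
  measurable [set o | forall i, (i <= n)%N -> W i o = w i].
Proof.
move=> mW; rewrite [X in measurable X](_ : _ =
    \bigcap_(i in `I_n.+1) W i @^-1` [set w i]).
  by apply: fin_bigcap_measurable => [|i _]; [exact: finite_II|exact: mW].
by apply/seteqP; split=> o h i /= /h.
Qed.

(** * The one-step law of the reduced process *)

Section PatternTransition.
Variables (R : realType) (Loc : countType) (Pat : finType).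
Variables (lambda : Pat -> Loc -> Loc -> R) (pi : Loc -> Loc -> R).
Hypothesis hPat : (1 <= #|Pat|)%N.
Hypothesis hlambda : forall s, stochastic_kernel (lambda s).
Hypothesis hpi : stochastic_kernel pi.

(** The old triple [t] determines the new state [x] through the learning rule, so only triples [v]
    carrying that state get mass. The responses have been averaged out by [kernel_comp]. *)
Definition pattern_transition (t v : {ffun Pat -> Loc} * Pat * Loc) : R :=
  let x := update t.1.1 t.1.2 t.2 in
  if v.1.1 == x
  then (#|Pat|%:R^-1 * kernel_comp (lambda v.1.2) pi (x v.1.2) v.2)%R else 0%R.

Lemma pattern_transition_stochastic : stochastic_kernel pattern_transition.
Proof.
have hk s := kernel_comp_stochastic (hlambda s) hpi.
have k0 t v : (0 <= pattern_transition t v)%R.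
  rewrite /pattern_transition; case: ifP => // _.
  by rewrite mulr_ge0 ?invr_ge0//; case: (hk v.1.2).
split=> // t.
rewrite esum_prodT; last by move=> v; rewrite lee_fin.
rewrite esum_prodT; last by move=> v; rewrite esum_ge0// => ? _; rewrite lee_fin.
(* The sum over patterns and outcomes is 1 at the updated state and 0 at every other state, so the
   total is that of a point mass. *)
rewrite -(@esum_delta _ _ (update t.1.1 t.1.2 t.2) 1)//.
apply: eq_esum => x _; rewrite /pattern_transition /=; case: eqP => [_|_].
  rewrite -(esum_uniform R hPat); apply: eq_esum => s _.
  have [h0 h1] := hk s.
  under eq_esum do rewrite EFinM.
  by rewrite esumZl ?h1 ?mule1// => u; rewrite lee_fin.
by apply: esum1 => s _; exact: esum1.
Qed.

Variables (d : measure_display) (Omega : measurableType d).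
Variable P : probability Omega R.
Variables (X : nat -> Omega -> {ffun Pat -> Loc}) (S : nat -> Omega -> Pat).
Variables (Y Z : nat -> Omega -> Loc).
Hypothesis hmodel : pattern_model P lambda pi X S Y Z.

Lemma before_trial_measurable n x s y z :
  measurable (before_trial X S Y Z n x s y z).
Proof.
have rv := pattern_rv hmodel.
rewrite [X in measurable X](_ : _ = X n @^-1` [set x n] `&`
  \bigcap_(i in `I_n) (X i @^-1` [set x i] `&` S i @^-1` [set s i] `&`
    Y i @^-1` [set y i] `&` Z i @^-1` [set z i])).
  apply: measurableI; first by case: (rv n).
  apply: fin_bigcap_measurable => [|i _]; first exact: finite_II.
  by have [mX mS mY mZ] := rv i; do 3 (apply: measurableI => //).
apply/seteqP; split=> w [Xn h]; split=> // i ni; have := h i ni.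
  by case.
by case=> -[[]].
Qed.

Lemma eq_before_trial n x s y z x' s' y' z' : x n = x' n ->
  (forall i, (i < n)%N ->
    [/\ x i = x' i, s i = s' i, y i = y' i & z i = z' i]) ->
  before_trial X S Y Z n x s y z = before_trial X S Y Z n x' s' y' z'.
Proof.
move=> xn h; apply/seteqP; rewrite /before_trial xn.
by split=> w [Xn hw]; split=> // i ni; have := hw i ni;
  have [-> -> -> ->] := h i ni.
Qed.

(** Split along the current response, apply the chain rule to pattern, response and outcome, then
    sum over the response. *)
Lemma pattern_marginal n x s y z s' z' :
  P (before_trial X S Y Z n x s y z `&` S n @^-1` [set s']
     `&` Z n @^-1` [set z']) =
  (#|Pat|%:R^-1 * kernel_comp (lambda s') pi (x n s') z')%:E *
  P (before_trial X S Y Z n x s y z).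
Proof.
have [mX mS mY mZ] := pattern_rv hmodel n.
set B := before_trial _ _ _ _ _ _ _ _ _.
have mB : measurable B by exact: before_trial_measurable.
have mSs := mS s'; have mZz := mZ z'.
have [l0 _] := hlambda s'; have [p0 _] := hpi.
(* The model reads the current pattern and response from [s n] and [y n]. Resetting these two
   entries, here and in [y2], leaves [B] unchanged, since it looks at patterns and responses of
   earlier trials only. *)
pose s2 i := if (i < n)%N then s i else s'.
rewrite (probability_esum_fibers P mY)//; last by do 2 (apply: measurableI => //).
transitivity (\esum_(u in [set: Loc])
   ((#|Pat|%:R^-1 * fine (P B))%:E * (lambda s' (x n s') u * pi u z')%:E)).
  apply: eq_esum => u _.
  have mYu := mY u.
  pose y2 i := if (i < n)%N then y i else u.
  have BE : B = before_trial X S Y Z n x s2 y2 z.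
    by apply: eq_before_trial => // i ni; rewrite /s2 /y2 ni.
  have s2n : s2 n = s' by rewrite /s2 ltnn.
  have y2n : y2 n = u by rewrite /y2 ltnn.
  have hS : P (S n @^-1` [set s'] `&` B) = #|Pat|%:R^-1%:E * P B.
    by apply: cond_prob_mul => // PB; exact: (pattern_sampling hmodel).
  have hY : P (Y n @^-1` [set u] `&` (B `&` S n @^-1` [set s'])) =
      (lambda s' (x n s') u)%:E * P (B `&` S n @^-1` [set s']).
    apply: cond_prob_mul => //; first exact: measurableI.
    rewrite BE -s2n => PB.
    exact: (pattern_prediction hmodel).
  have hZ : P (Z n @^-1` [set z'] `&`
        (B `&` S n @^-1` [set s'] `&` Y n @^-1` [set u])) =
      (pi u z')%:E * P (B `&` S n @^-1` [set s'] `&` Y n @^-1` [set u]).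
    apply: cond_prob_mul => //; first by do 2 (apply: measurableI => //).
    rewrite BE -s2n -y2n => PB.
    exact: (pattern_outcome hmodel).
  (* Peel off the outcome, then the response, then the pattern. *)
  rewrite setIAC setIC hZ setIC hY setIC hS.
  have fB : P B \is a fin_num by exact: fin_num_measure.
  rewrite -[in LHS](fineK fB) -!EFinM; congr EFin.
  by rewrite mulrCA [RHS]mulrC -!mulrA; congr (_ * _)%R; rewrite mulrCA.
rewrite esumZl; last 2 first.
- by rewrite mulr_ge0 ?invr_ge0 ?fine_ge0.
- by move=> u; rewrite lee_fin mulr_ge0.
rewrite -kernel_compE// -[P B in RHS]fineK ?fin_num_measure//.
by rewrite -!EFinM mulrAC.
Qed.

Lemma reduced_rv n : discrete_rv (fun o => (X n o, S n o, Z n o)).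
Proof.
by have [? ? _ ?] := pattern_rv hmodel n; do 2 (apply: discrete_rv_pair => //).
Qed.

(** The model conditions on full histories, so [H] is split by its responses. The factor from
    [pattern_marginal] is the same on every piece and comes out of the sum. *)
Lemma reduced_transition n (w : nat -> {ffun Pat -> Loc} * Pat * Loc) v :
  let H := [set o | forall i, (i <= n)%N -> (X i o, S i o, Z i o) = w i] in
  P ((fun o => (X n.+1 o, S n.+1 o, Z n.+1 o)) @^-1` [set v] `&` H) =
  (pattern_transition (w n) v)%:E * P H.
Proof.
move=> H.
have rv := pattern_rv hmodel.
have mH : measurable H by exact: discrete_history_measurable reduced_rv.
pose x0 := update (w n).1.1 (w n).1.2 (w n).2.
have Hneg : P.-negligible (H `&` ~` (X n.+1 @^-1` [set x0])).
  apply: negligibleS (pattern_learning hmodel n) => o [/(_ n (leqnn n)) Wn Xn] /= Xn1.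
  by apply: Xn; rewrite /= Xn1 /x0 -Wn.
rewrite /pattern_transition -/x0; case: v => [[x' s'] z'] /=.
(* If [v] carries a state other than [x0], the event lies inside the null set of [Hneg]. *)
case: eqP => [->|xN]; last first.
  rewrite mul0e; apply: measure_negligible.
    by apply: measurableI => //; exact: reduced_rv.
  apply: negligibleS Hneg => o [/= [Xo _ _] Ho]; split=> //= Xo'.
  by apply: xN; rewrite -Xo.
(* Bundled as a finite function, the responses on trials [0] to [n] form one variable with countably
   many values. *)
have mYs : discrete_rv (fun o => [ffun i : 'I_n.+1 => Y i o]).
  by apply: discrete_rv_ffun => i; case: (rv i).
have [k0 _] := kernel_comp_stochastic (hlambda s') hpi.
rewrite (probability_esum_fibers P mYs); last first.
  by apply: measurableI => //; exact: reduced_rv.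
rewrite (probability_esum_fibers P mYs mH) -esumZl ?mulr_ge0 ?invr_ge0//.
apply: eq_esum => f _.
(* A [before_trial] event at [n.+1] also reads the state at index [n.+1], on which [H] imposes
   nothing directly; it is set to [x0]. *)
pose x i := if (i <= n)%N then (w i).1.1 else x0.
pose s i := (w i).1.2.
(* Indices above [n], where [inord] gives a default, are never read. *)
pose y (i : nat) := f (inord i).
pose z i := (w i).2.
have xn1 : x n.+1 = x0 by rewrite /x ltnn.
have fE o : [ffun i : 'I_n.+1 => Y i o] = f <->
    forall i, (i <= n)%N -> Y i o = y i.
  split=> [ho i ni|h]; first by rewrite /y -ho ffunE inordK.
  by apply/ffunP => i; rewrite ffunE (h i (ltn_ord i)) /y inord_val.
have BE : H `&` (fun o => [ffun i : 'I_n.+1 => Y i o]) @^-1` [set f]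
    `&` X n.+1 @^-1` [set x0] = before_trial X S Y Z n.+1 x s y z.
  apply/seteqP; split=> o /=.
    case=> -[Ho /fE Yo] Xo; split=> [|i]; first by rewrite xn1.
    rewrite ltnS => ni; have Wi := Ho i ni.
    by rewrite /x /s /z ni -Wi Yo.
  case=> Xo ho; split; last by rewrite -xn1.
  split; last by apply/fE => i ni; case: (ho i ni).
  move=> i ni; have [-> -> _ ->] := ho i ni.
  by rewrite /x /s /z ni; case: (w i) => -[].
transitivity (P (before_trial X S Y Z n.+1 x s y z `&` S n.+1 @^-1` [set s']
     `&` Z n.+1 @^-1` [set z'])).
  (* Here the constraint that the new state be [x0] is already part of the event for [v]. *)
  congr (P _); rewrite -BE; apply/seteqP; split=> o /=.
    by case=> -[[-> -> ->] ?] ?.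
  by case=> -[[[? ?] ->] ->] ->.
(* On the right-hand side that constraint is absent, but imposing it removes only a null set, by
   [Hneg]. *)
rewrite pattern_marginal xn1; congr (_ * _); rewrite -BE measureI_ae//.
- by apply: measurableI => //; exact: mYs.
- by have [mX _ _ _] := rv n.+1; exact: mX.
- by apply: negligibleS Hneg => o [[]].
Qed.

End PatternTransition.

Theorem mainTheorem2 (R : realType) (Loc : countType) (Pat : finType)
    (hPat : (1 <= #|Pat|)%N)
    (lambda : Pat -> Loc -> Loc -> R) (pi : Loc -> Loc -> R)
    (hlambda : forall s, stochastic_kernel (lambda s))
    (hpi : stochastic_kernel pi)
    (d : measure_display) (Omega : measurableType d) (P : probability Omega R)
    (X : nat -> Omega -> {ffun Pat -> Loc}) (S : nat -> Omega -> Pat)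
    (Y Z : nat -> Omega -> Loc)
    (hmodel : pattern_model P lambda pi X S Y Z) :
  is_markov_chain P (fun n o => (X n o, S n o, Z n o)).
Proof.
have mW := reduced_rv hmodel.
split=> //; exists (pattern_transition lambda pi); split.
  exact: pattern_transition_stochastic.
move=> n w v H PH; apply/cond_probP => //.
- exact: mW.
- exact: discrete_history_measurable mW.
- exact: (reduced_transition hlambda hpi hmodel).
Qed.
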